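(* Let $\mathcal{X}$ be a non-empty class of complete metric spaces satisfying the six assumptions $(\mathrm{S}_{+})$, $(\mathrm{U})$, $(\mathrm{NPC}1)$, $(\mathrm{NPC}2)$, $(\mathrm{NPC}3)$ and $(\mathrm{TP})$ (defined in the context). Let $G$ be a finitely generated group, let $M,L\leqslant G$ be subgroups and let $\Pi\leqslant \mathrm{Aut}(G)$ be a subgroup. Assume that: (i) the union $M\cup L$ generates $G$; (ii) the group $\Pi$ is finite; (GAME) the player has a winning strategy for the $(\mathrm{Game})$ for $(M,L,\Pi)$ (defined in the context). If both $G\geqslant M$ and $G\geqslant L$ have relative property $(\mathrm{F}_{\mathcal{X}})$, then $G$ has property $(\mathrm{F}_{\mathcal{X}})$.
   Context: Conventions: all metric spaces are non-empty and complete; all group actions on metric spaces are by isometries. For an action $\alpha\colon \Lambda\curvearrowright X$ and $M\leqslant \Lambda$, $X^{\alpha(M)}=\{x\in X:\alpha(h)\cdot x=x \text{ for all } h\in M\}$. For a countable group $\Lambda$ and $M\leqslant\Lambda$, the pair $\Lambda\geqslant M$ has relative property $(\mathrm{F}_{\mathcal{X}})$ if for every $X\in\mathcal{X}$ and every action $\alpha\colon\Lambda\curvearrowright X$ one has $X^{\alpha(M)}\neq\emptyset$. A finitely generated group $G$ has property $(\mathrm{F}_{\mathcal{X}})$ if $G\geqslant G$ has relative property $(\mathrm{F}_{\mathcal{X}})$. Geodesic segments are minimal (isometric embeddings of real segments). In a uniquely geodesic space $(X,d)$ (every pair of points is joined by a unique geodesic segment), $[x,y]$ is the oriented geodesic segment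 from $x$ to $y$, and for $0\le t\le 1$, $m_t[x,y]$ is the point of $[x,y]$ dividing it internally at ratio $t:(1-t)$. Write $[x,y]\,||\,[x',y']$ if $d(x,x')=d(y,y')=d(m_{1/2}[x,y],m_{1/2}[x',y'])$. Assumptions on $\mathcal{X}$ (a condition on spaces is required for every $X\in\mathcal{X}$): - $(\mathrm{S}_{+})$: for $(X,d)\in\mathcal{X}$ and $r\geq 1$, $(X,rd)\in\mathcal{X}$. - $(\mathrm{U})$: there is a non-principal ultrafilter $\mathcal{U}$ on $\mathbb{N}$ such that for all $X_n\in\mathcal{X}$ and $w_n\in X_n$ ($n\in\mathbb{N}$), the pointed metric ultraproduct $\lim_{\mathcal{U}}(X_n,w_n)$ belongs to $\mathcal{X}$ (after forgetting the base point). Here $\lim_{\mathcal{U}}(X_n,d_n,w_n)$ is the quotient of $\{(x_n)_n\in\prod X_n:\sup_n d_n(x_n,w_n)<\infty\}$ with semi-metric $\lim_{\mathcal{U}}d_n(x_n,y_n)$ by the relation of being at distance $0$, with base point $[(w_n)_n]$. - $(\mathrm{NPC}1)$: $X$ is uniquely geodesic, and for all geodesic segments $[x,y],[x',y']$ with $d(x,x')=d(y,y')$ and all $0\le t\le 1$, $d(m_t[x,y],m_t[x',y'])\le d(x,x')$. - $(\mathrm{NPC}2)$: if $[x,y]\,||\,[x',y']$, then $[x,x']\,||\,[y,y']$. - $(\mathrm{NPC}3)$: if $[x,y]\,||\,[y,z]$, then the concatenation $[x,y]\cup[y,z]$ is a geodesic. - $(\mathrm{TP})$: if $[x,y]\,||\,[x',y']$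 and $[x',y']\,||\,[x'',y'']$, then $[x,y]\,||\,[x'',y'']$. The $(\mathrm{Game})$ for $(M,L,\Pi)$: a one-player game with $M,L,\Pi$ fixed and two subgroups $H_1,H_2\leqslant G$ varying stage by stage. Initially $H_1=M$, $H_2=L$. At each stage the player may perform one of the following moves. - Type $(\mathrm{I})$ move: pick a subset $P\subseteq G$ such that $hH_1h^{-1}\geqslant M$ and $hH_2h^{-1}\geqslant L$ for all $h\in P$, and such that the abelianization $Q^{\mathrm{abel}}$ of $Q:=\langle P\rangle$ is a torsion group. Then replace $H_1$ by $\langle H_1,P\rangle$ and $H_2$ by $\langle H_2,P\rangle$. - Type $(\mathrm{II}_{\sigma})$ move, for $\sigma\in\mathrm{Sym}(2)$: pick a subset $\Lambda\subseteq\mathrm{Inn}(G)\cdot\Pi$ such that $H_{\sigma^{-1}(1)}\geqslant\phi(M)$ and $H_{\sigma^{-1}(2)}\geqslant\phi(L)$ for all $\phi\in\Lambda$. Then simultaneously replace $H_1$ by $\langle H_1,\bigcup_{\phi\in\Lambda}\phi(H_{\sigma(1)})\rangle$ and $H_2$ by $\langle H_2,\bigcup_{\phi\in\Lambda}\phi(H_{\sigma(2)})\rangle$. The player wins if after finitely many moves $H_1=G$ or $H_2=G$. *)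

(* Defs.v *)
From HB Require Import structures.
From Stdlib Require Import Relation_Operators.
From mathcomp Require Import all_boot all_order all_algebra perm.
From mathcomp Require Import all_classical all_reals topology normedtype.

Set Implicit Arguments.
Unset Strict Implicit.
Unset Printing Implicit Defensive.

Import Order.TTheory GRing.Theory Num.Theory.
Import numFieldNormedType.Exports.

Local Open Scope classical_set_scope.
Local Open Scope ring_scope.

Section Groups.
Context {G : groupType}.
Local Open Scope group_scope.

Definition subgroup (H : set G) : Prop :=
  [/\ H 1, (forall x y, H x -> H y -> H (x * y)) & forall x, H x -> H x^-1].

Definition gen (A : set G) : set G := smallest subgroup A.

Definition fin_gen : Prop := exists2 S : set G, finite_set S & gen S = setT.

Definition inn (g : G) : G -> G := fun x => g * x * g^-1.

Definition automorphism (phi : G -> G) : Prop :=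
  {morph phi : x y / x * y} /\ bijective phi.

(* The group Aut(G) is not a type here: a subgroup of it is a set of maps. *)
Definition aut_subgroup (Pi : set (G -> G)) : Prop :=
  [/\ Pi `<=` automorphism, Pi idfun,
      (forall phi psi, Pi phi -> Pi psi -> Pi (phi \o psi)) &
      forall phi psi, Pi phi -> cancel phi psi -> cancel psi phi -> Pi psi].

Definition inn_mul (Pi : set (G -> G)) : set (G -> G) :=
  [set phi | exists g, exists2 pi, Pi pi & phi = inn g \o pi].

Definition derived (Q : set G) : set G :=
  gen [set z | exists x y, [/\ Q x, Q y & z = [~ x, y]]].

(* Q / [Q, Q] is a torsion group. *)
Definition torsion_abelianization (Q : set G) : Prop :=
  forall q, Q q -> exists2 n, (0 < n)%N & derived Q (q ^+ n).

End Groups.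
Arguments fin_gen : clear implicits.

Section Game.
Variable G : groupType.
Implicit Types (H K : 'I_2 -> set G) (Pi : set (G -> G)).

(* The indices 1, 2 of the game are the elements of 'I_2; a position is
   H : 'I_2 -> set G, and K is the initial position (M, L). *)
Definition pair_of (M L : set G) : 'I_2 -> set G :=
  fun i => if i == ord0 then M else L.

Definition move_I K H H' : Prop := exists P : set G,
  [/\ forall i h, P h -> K i `<=` inn h @` H i,
      torsion_abelianization (gen P) &
      forall i, H' i = gen (H i `|` P)].

Definition move_II K Pi (s : 'S_2) H H' : Prop := exists La : set (G -> G),
  [/\ La `<=` inn_mul Pi,
      forall i phi, La phi -> phi @` K i `<=` H ((s^-1)%g i) &
      forall i, H' i = gen (H i `|` \bigcup_(phi in La) phi @` H (s i))].

Definition move K Pi H H' : Prop :=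
  move_I K H H' \/ exists s, move_II K Pi s H H'.

(* The game has one player and no randomness: a winning strategy is a finite
   sequence of moves leading to a winning position. *)
Definition game_winnable (M L : set G) Pi : Prop :=
  let K := pair_of M L in
  exists2 H, clos_refl_trans _ (move K Pi) K H & exists i, H i = setT.

End Game.

Section Metric.
Context {R : realType}.
Implicit Types X Y : metricType R.

Definition complete_space X : Prop :=
  forall F : set_system X, ProperFilter F -> cauchy F -> exists x : X, F --> x.

Definition isometric X Y : Prop :=
  exists2 f : X -> Y, bijective f & forall x y, mdist (f x) (f y) = mdist x y.

(* A metricType carries data besides its distance (such as a choice operator),
   so membership of a constructed space in a class is meant up to isometry. *)
Definition belongs (XX : metricType R -> Prop) X : Prop :=
  exists2 Y, XX Y & isometric X Y.

Definition geodesic_path X (x y : X) (c : R -> X) : Prop :=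
  [/\ c 0 = x, c (mdist x y) = y &
      {in `[0, mdist x y] &, forall s t, mdist (c s) (c t) = `|s - t|}].

Definition geodesic_segment X (x y : X) (S : set X) : Prop :=
  exists2 c, geodesic_path x y c & S = c @` `[0, mdist x y].

Definition uniquely_geodesic X : Prop :=
  forall x y : X, exists! S, geodesic_segment x y S.

(* [x, y], meaningful in a uniquely geodesic space. *)
Definition seg X (x y : X) : set X := xget set0 (geodesic_segment x y).

(* m_t[x, y], meaningful in a uniquely geodesic space for 0 <= t <= 1. *)
Definition divpt X (t : R) (x y : X) : X :=
  xget x [set p | [/\ seg x y p, mdist x p = t * mdist x y &
                      mdist p y = (1 - t) * mdist x y]].

(* [x, y] || [x', y'] *)
Definition parallel X (x y x' y' : X) : Prop :=
  mdist x x' = mdist y y' /\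
  mdist y y' = mdist (divpt 2^-1 x y) (divpt 2^-1 x' y').

Definition NPC1 X : Prop :=
  uniquely_geodesic X /\
  forall (x y x' y' : X) (t : R), mdist x x' = mdist y y' -> 0 <= t <= 1 ->
    mdist (divpt t x y) (divpt t x' y') <= mdist x x'.

Definition NPC2 X : Prop :=
  forall x y x' y' : X, parallel x y x' y' -> parallel x x' y y'.

Definition NPC3 X : Prop :=
  forall x y z : X, parallel x y y z ->
    geodesic_segment x z (seg x y `|` seg y z).

Definition TP X : Prop :=
  forall x y x' y' x'' y'' : X, parallel x y x' y' -> parallel x' y' x'' y'' ->
    parallel x y x'' y''.

End Metric.

Section Rescale.
Context {R : realType}.

(* The space (X, r d). *)
Definition rescale (r : R) (r1 : 1 <= r) (X : metricType R) : Type := X.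

Variables (r : R) (r1 : 1 <= r) (X : metricType R).
Notation T := (rescale r1 X).

HB.instance Definition _ := Choice.copy T X.

Definition rescale_dist (x y : T) : R := r * mdist (x : X) (y : X).

Let r0 : 0 < r. Proof. exact: lt_le_trans r1. Qed.

Let rescale_xx x : rescale_dist x x = 0.
Proof. by rewrite /rescale_dist mdistxx mulr0. Qed.

Let rescale_pos x y : rescale_dist x y = 0 -> x = y.
Proof.
move/eqP; rewrite mulf_eq0 gt_eqF //= => /eqP.
exact: mdist_positivity.
Qed.

Let rescale_sym x y : rescale_dist x y = rescale_dist y x.
Proof. by rewrite /rescale_dist metric_sym. Qed.

Let rescale_triangle y x z :
  rescale_dist x z <= rescale_dist x y + rescale_dist y z.
Proof. by rewrite -mulrDr ler_pM2l // metric_triangle. Qed.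

HB.instance Definition _ :=
  isMetric.Build R T rescale_xx rescale_pos rescale_sym rescale_triangle.

End Rescale.

Section Ultraproduct.
Context {R : realType}.
Variables (U : set_system nat) (UU : UltraFilter U).
Variables (X : nat -> metricType R) (w : forall n, X n).

Definition bounded_from (x : forall n, X n) : bool :=
  `[< exists C : R, forall n, mdist (x n) (w n) <= C >].

Definition bounded_seq : Type := {x : forall n, X n | bounded_from x}.
HB.instance Definition _ := Choice.on bounded_seq.

Definition ulim_dist (x y : bounded_seq) : R :=
  lim ((fun n => mdist (val x n) (val y n)) @ U).

Lemma ulim_dist_cvg (x y : bounded_seq) :
  (fun n => mdist (val x n) (val y n)) @ U --> ulim_dist x y.
Proof.
have /asboolP[C xC] := valP x; have /asboolP[D yD] := valP y.
set f := fun n => _.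
have fU : UltraFilter (f @ U).
  split=> [|F FF fF]; first exact: fmap_proper_filter.
  rewrite eqEsubset; split=> // A FA.
  have [//|nA] := in_ultra_setVsetC (f @^-1` A) UU.
  have /fF FnA : (f @ U) (~` A) by [].
  have : F (A `&` ~` A) by exact: filterI.
  by rewrite setICr => /filter_not_empty.
have fCD : (f @ U) [set` `[0, C + D]].
  apply: (@filterE _ U) => n /=; rewrite in_itv /= /f mdist_ge0 /=.
  apply: le_trans (metric_triangle _ (w n) _) _.
  by apply: lerD; rewrite // metric_sym.
have := @segment_compact R 0 (C + D); rewrite compact_ultra => /(_ _ fU fCD).
by move=> [l [_ fl]]; apply: cvgP fl.
Qed.

Let ulim_xx x : ulim_dist x x = 0.
Proof.
apply: cvg_lim => //; under eq_fun do rewrite mdistxx.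
exact: cvg_cst.
Qed.

Let ulim_sym x y : ulim_dist x y = ulim_dist y x.
Proof. by congr lim; congr (_ @ U); apply/funext => n; rewrite metric_sym. Qed.

Let ulim_triangle y x z : ulim_dist x z <= ulim_dist x y + ulim_dist y z.
Proof.
have xz := @ulim_dist_cvg x z.
have xyz := cvgD (@ulim_dist_cvg x y) (@ulim_dist_cvg y z).
apply: (ler_cvg_to xz (xyz _)).
by apply: (@filterE _ U) => n; exact: metric_triangle.
Qed.

Let ulim_ge0 x y : 0 <= ulim_dist x y.
Proof.
have := ulim_triangle y x x.
by rewrite ulim_xx [in ulim_dist y x]ulim_sym -mulr2n pmulrn_lge0 //.
Qed.

Definition at_dist0 : rel bounded_seq := fun x y => ulim_dist x y == 0.

Let at_dist0_refl : reflexive at_dist0.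
Proof. by move=> x; apply/eqP. Qed.

Let at_dist0_sym : symmetric at_dist0.
Proof. by move=> x y; rewrite /at_dist0 ulim_sym. Qed.

Let at_dist0_trans : transitive at_dist0.
Proof.
move=> y x z /eqP xy /eqP yz; rewrite /at_dist0 eq_le ulim_ge0 andbT.
by rewrite (le_trans (ulim_triangle y _ _)) // xy yz addr0.
Qed.

Canonical at_dist0_equiv :=
  EquivRel at_dist0 at_dist0_refl at_dist0_sym at_dist0_trans.

(* lim_U (X_n, w_n), without its base point. *)
Definition ultraproduct : Type := {eq_quot at_dist0}%qT.
HB.instance Definition _ := Choice.on ultraproduct.
HB.instance Definition _ := EqQuotient.on ultraproduct.

Definition ultra_dist (a b : ultraproduct) : R := ulim_dist (repr a) (repr b).

Let at_dist0P x y : reflect (\pi_ultraproduct x = \pi_ultraproduct y)%qT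
  (ulim_dist x y == 0).
Proof. by apply: (iffP idP) => [xy|/eqmodP//]; apply/eqmodP. Qed.

Let ulim_congr x x' y : at_dist0 x x' -> ulim_dist x y = ulim_dist x' y.
Proof.
move=> /eqP xx'; apply/eqP; rewrite eq_le.
have := ulim_triangle x' x y; rewrite xx' add0r => ->.
by have := ulim_triangle x x' y; rewrite (ulim_sym x' x) xx' add0r => ->.
Qed.

Lemma ultra_distE (x y : bounded_seq) :
  ultra_dist (\pi_ultraproduct x)%qT (\pi_ultraproduct y)%qT = ulim_dist x y.
Proof.
have E z : at_dist0 (repr (\pi_ultraproduct z)%qT) z.
  by apply/at_dist0P; rewrite reprK.
by rewrite /ultra_dist (ulim_congr _ (E x)) ulim_sym (ulim_congr _ (E y)).
Qed.

Let ultra_xx a : ultra_dist a a = 0. Proof. exact: ulim_xx. Qed.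

Let ultra_pos a b : ultra_dist a b = 0 -> a = b.
Proof. by move/eqP/at_dist0P; rewrite !reprK. Qed.

Let ultra_sym a b : ultra_dist a b = ultra_dist b a.
Proof. exact: ulim_sym. Qed.

Let ultra_triangle b a c : ultra_dist a c <= ultra_dist a b + ultra_dist b c.
Proof. exact: ulim_triangle. Qed.

HB.instance Definition _ :=
  isMetric.Build R ultraproduct ultra_xx ultra_pos ultra_sym ultra_triangle.

End Ultraproduct.

Section Classes.
Context {R : realType}.
Implicit Type XX : metricType R -> Prop.

Definition S_plus XX : Prop :=
  forall (X : metricType R) (r : R) (r1 : 1 <= r), XX X ->
    belongs XX (rescale r1 X).

Definition nonprincipal (U : set_system nat) : Prop :=
  forall n, U <> principal_filter n.

Definition U_closed XX : Prop :=
  exists (U : set_system nat) (UU : UltraFilter U), nonprincipal U /\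
    forall (X : nat -> metricType R) (w : forall n, X n),
      (forall n, XX (X n)) -> belongs XX (ultraproduct UU w).

End Classes.

Record isom_action (R : realType) (G : groupType) (X : metricType R) := {
  act :> G -> X -> X;
  act1 : forall x, act 1%g x = x;
  actM : forall g h x, act (g * h)%g x = act g (act h x);
  act_isom : forall g x y, mdist (act g x) (act g y) = mdist x y }.

Section PropertyF.
Context {R : realType} (XX : metricType R -> Prop) (G : groupType).

Definition fixed_points (X : metricType R) (a : isom_action G X) (M : set G) :
    set X := [set x | forall h, M h -> a h x = x].

Definition relative_F (M : set G) : Prop :=
  forall X, XX X -> forall a : isom_action G X, fixed_points a M !=set0.

Definition property_F : Prop := relative_F setT.

End PropertyF.

(* Main.v *)
(** Suppose G fails the fixed point property. Ultraproducts and rescaling turn a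
    fixed-point-free action into one whose displacement function (a sum over a
    Pi-invariant finite generating list) is bounded below by some c > 0, and a
    second ultraproduct realizes the infimum D of the distances between an
    M-fixed point and an L-fixed point over all such actions on spaces of the
    class. The invariant of the game is that, for every action realizing D at
    (z_1, z_2), H_1 fixes z_1 and H_2 fixes z_2.

    A type II move preserves it because the actions with displacement at least
    c are stable under precomposition with Inn(G) Pi. For a type I move and
    h in P, the pair (h z_1, h z_2) realizes D again, and the midpoints of
    [z_1, h z_1] and [z_2, h z_2] are fixed by M and L; hence
    [z_1, h z_1] || [z_2, h z_2]. As M and L generate G, h translates z_1 in a
    G-invariant way. Such translations commute at z_1 and have no torsion by
    (NPC3), so the torsion of the abelianization forces h z_1 = z_1.

    Winning would thus give a G-fixed point, whose displacement is 0 < c. *)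

Require Import Defs.
From Stdlib Require Import Relation_Operators.
From mathcomp Require Import all_boot all_order all_algebra perm.
From mathcomp Require Import all_classical all_reals topology normedtype.
From mathcomp Require Import ring lra.

Set Implicit Arguments.
Unset Strict Implicit.
Unset Printing Implicit Defensive.

Import Order.TTheory GRing.Theory Num.Theory.
Import numFieldNormedType.Exports.

Local Open Scope classical_set_scope.
Local Open Scope ring_scope.

(** * Generated subgroups and automorphisms *)

Section GroupFacts.
Context {G : groupType}.
Local Open Scope group_scope.
Implicit Types (A H : set G) (phi : G -> G).

Lemma sub_gen A : A `<=` gen A.
Proof. exact: sub_smallest. Qed.

Lemma gen_min A H : subgroup H -> A `<=` H -> gen A `<=` H.
Proof. exact: smallest_sub. Qed.

Lemma gen_subgroup A : subgroup (gen A).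
Proof.
split=> [H [[H1 _ _] _] //|x y Ax Ay H HA|x Ax H HA].
  by have [[_ HM _] _] := HA; apply: HM; [apply: Ax|apply: Ay].
by have [[_ _ HV] _] := HA; apply: HV; apply: Ax.
Qed.

Lemma morphism1 phi : {morph phi : x y / x * y} -> phi 1 = 1.
Proof. by move=> phiM; apply: (mulgI (phi 1)); rewrite -phiM !mulg1. Qed.

Lemma inn_morph (g : G) : {morph inn g : x y / x * y}.
Proof. by move=> x y; rewrite /inn !mulgA mulgVK. Qed.

Lemma inn_mul_morph (Pi : set (G -> G)) phi :
  aut_subgroup Pi -> inn_mul Pi phi -> {morph phi : x y / x * y}.
Proof.
move=> [Piaut _ _ _] [g [pi /Piaut[piM _] ->]] x y /=.
by rewrite piM inn_morph.
Qed.

End GroupFacts.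

(** * Geodesic segments, dividing points and parallelism *)

Section Isometries.
Context {R : realType}.
Implicit Types X Y : metricType R.

Lemma geodesic_segment_isom X Y (f : X -> Y) (x y : X) S :
  (forall p q, mdist (f p) (f q) = mdist p q) ->
  geodesic_segment x y S -> geodesic_segment (f x) (f y) (f @` S).
Proof.
move=> fd [c [c0 c1 cd] ->]; exists (f \o c); last by rewrite image_comp fd.
by split=> [||s t s_in t_in] /=; rewrite ?c0 ?fd ?c1 // -cd // -(fd x y).
Qed.

Lemma geodesic_segment_sym X (x y : X) S :
  geodesic_segment x y S -> geodesic_segment y x S.
Proof.
move=> [c [c0 c1 cd] ->]; have cE : mdist y x = mdist x y by exact: metric_sym.
have flip s : s \in `[0, mdist x y] -> mdist x y - s \in `[0, mdist x y].
  by rewrite !in_itv /=; lra.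
exists (fun s => c (mdist x y - s)).
  split; rewrite ?subr0 ?cE ?subrr // => s t s_in t_in.
  by rewrite cd ?flip // [RHS]distrC; congr `|_|; ring.
rewrite cE; apply/seteqP; split=> _ [s s_in <-] /=; exists (mdist x y - s);
  by rewrite ?subKr //; exact: flip.
Qed.

Lemma geodesic_segment_dist X (x y p : X) S :
  geodesic_segment x y S -> S p -> mdist x y = mdist x p + mdist p y.
Proof.
move=> [c [c0 c1 cd] ->] [s s_in <-] /=; have := mdist_ge0 x y => d0.
move: (s_in); rewrite /= in_itv /= => /andP[s0 sd].
have -> : mdist x (c s) = s.
  by rewrite -{1}c0 cd ?sub0r ?normrN ?ger0_norm // in_itv /= lexx d0.
have -> : mdist (c s) y = mdist x y - s.
  have d_in : mdist x y \in `[0, mdist x y] by rewrite in_itv /= d0 lexx.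
  by rewrite -{1}c1 (cd _ _ s_in d_in) distrC ger0_norm // subr_ge0.
ring.
Qed.

End Isometries.

Section UniquelyGeodesic.
Context {R : realType} (X : metricType R) (geo : uniquely_geodesic X).
Implicit Types (x y z p q : X) (t : R).

Lemma segP x y : geodesic_segment x y (seg x y).
Proof. by have [S [HS _]] := geo x y; apply: (xgetPex set0); exists S. Qed.

Lemma seg_unique x y S : geodesic_segment x y S -> S = seg x y.
Proof.
by have [S0 [_ S0P]] := geo x y => HS; rewrite -(S0P _ HS) -(S0P _ (segP x y)).
Qed.

Lemma seg_sym x y : seg x y = seg y x.
Proof. by apply: seg_unique; apply: geodesic_segment_sym; exact: segP. Qed.

Lemma seg_r x y : seg x y y.
Proof.
have [c [c0 c1 cd] ->] := segP x y; exists (mdist x y) => //=.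
by rewrite in_itv /= mdist_ge0 lexx.
Qed.

Lemma seg_dist_inj x y p q :
  seg x y p -> seg x y q -> mdist x p = mdist x q -> p = q.
Proof.
have [c [c0 c1 cd] ->] := segP x y; have d0 := mdist_ge0 x y.
move=> [s /= s_in <-] [t /= t_in <-].
have z_in : 0 \in `[0, mdist x y] by rewrite in_itv /= lexx d0.
rewrite -c0 !cd //; move: s_in t_in; rewrite !in_itv /= !sub0r !normrN.
by move=> /andP[s0 _] /andP[t0 _]; rewrite !ger0_norm // => ->.
Qed.

Lemma divptP t x y : 0 <= t <= 1 ->
  [/\ seg x y (divpt t x y), mdist x (divpt t x y) = t * mdist x y &
      mdist (divpt t x y) y = (1 - t) * mdist x y].
Proof.
move=> t01; rewrite /divpt; set P := [set p | _].
suff: P (xget x P) by [].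
apply: (xgetPex x).
have [c [c0 c1 cd] segE] := segP x y; have d0 := mdist_ge0 x y.
have [z_in d_in td_in] : [/\ 0 \in `[0, mdist x y],
    mdist x y \in `[0, mdist x y] & t * mdist x y \in `[0, mdist x y]].
  by rewrite !in_itv /=; split; nra.
have c_t : mdist x (c (t * mdist x y)) = t * mdist x y.
  by rewrite -{1}c0 cd // sub0r normrN ger0_norm //; nra.
exists (c (t * mdist x y)); split=> //.
  by rewrite segE; exists (t * mdist x y).
have : seg x y (c (t * mdist x y)) by rewrite segE; exists (t * mdist x y).
by move=> /(geodesic_segment_dist (segP x y)); rewrite c_t; lra.
Qed.

Lemma divpt_unique t x y p : 0 <= t <= 1 ->
  seg x y p -> mdist x p = t * mdist x y -> p = divpt t x y.
Proof.
move=> t01 sp px; have [sd dx _] := divptP x y t01.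
by apply: (seg_dist_inj sp sd); rewrite px dx.
Qed.

Lemma divpt_isom (f : X -> X) t x y :
  (forall p q, mdist (f p) (f q) = mdist p q) -> 0 <= t <= 1 ->
  f (divpt t x y) = divpt t (f x) (f y).
Proof.
move=> fd t01; have [sd dx _] := divptP x y t01.
apply: divpt_unique; rewrite ?fd //.
rewrite -(seg_unique (geodesic_segment_isom fd (segP x y))).
by exists (divpt t x y).
Qed.

Lemma half01 : 0 <= (2^-1 : R) <= 1. Proof. lra. Qed.

Lemma midpoint_sym x y : divpt 2^-1 x y = divpt 2^-1 y x.
Proof.
have [sd dx dy] := divptP x y half01; apply: (divpt_unique half01).
  by rewrite seg_sym.
by rewrite metric_sym dy [mdist y x]metric_sym; lra.
Qed.

Lemma midpoint_xx x : divpt 2^-1 x x = x.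
Proof.
have [_ + _] := divptP x x half01; rewrite mdistxx mulr0.
by move/mdist_positivity.
Qed.

Lemma parallel_refl x y : parallel x y x y.
Proof. by rewrite /parallel !mdistxx. Qed.

Lemma parallel_sym x y x' y' : parallel x y x' y' -> parallel x' y' x y.
Proof.
case=> e1 e2; split; first by rewrite metric_sym e1 metric_sym.
by rewrite metric_sym e2 metric_sym.
Qed.

Lemma parallel_rev x y x' y' : parallel x y x' y' -> parallel y x y' x'.
Proof.
case=> e1 e2; split=> //.
by rewrite e1 e2 midpoint_sym [X in mdist _ X]midpoint_sym.
Qed.

Lemma parallel_isom (f : X -> X) x y x' y' :
  (forall p q, mdist (f p) (f q) = mdist p q) ->
  parallel x y x' y' -> parallel (f x) (f y) (f x') (f y').
Proof.
by move=> fd [e1 e2]; split; rewrite -?divpt_isom ?half01 // !fd.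
Qed.

Lemma parallel_xx x y : parallel x x y y.
Proof. by rewrite /parallel !midpoint_xx. Qed.

Hypothesis npc3 : NPC3 X.

(** By (NPC3) [y] lies on a geodesic from [x] to [z], so distances add up; parallelism makes the two
    summands equal. *)
Lemma parallel_double x y z : parallel x y y z -> mdist x z = 2 * mdist x y.
Proof.
move=> xyz; have [e _] := xyz.
rewrite (geodesic_segment_dist (p := y) (npc3 xyz)); first by rewrite -e; lra.
by left; exact: seg_r.
Qed.

End UniquelyGeodesic.

(** * Parallel translations of an orbit *)

Section Actions.
Context {R : realType} {G : groupType} {X : metricType R}.
Variable a : isom_action G X.
Implicit Types (g h q : G) (x y : X).

Lemma actK g x : a g^-1%g (a g x) = x.
Proof. by rewrite -actM mulVg act1. Qed.

Lemma actVK g x : a g (a g^-1%g x) = x.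
Proof. by rewrite -actM mulgV act1. Qed.

Lemma stabilizer_subgroup x : subgroup [set h | a h x = x].
Proof.
split=> [|g h /= gx hx|g /= gx]; first exact: act1.
  by rewrite actM hx gx.
by rewrite -{1}gx actK.
Qed.

Lemma mdist_act_pow q x n :
  mdist x (a (q ^+ n)%g x) <= n%:R * mdist x (a q x).
Proof.
elim: n => [|n IH]; first by rewrite expg0 act1 mdistxx mul0r.
apply: le_trans (metric_triangle _ (a (q ^+ n)%g x) _) _.
by rewrite expgSr actM act_isom -natr1 mulrDl mul1r lerD2r.
Qed.

Section Translations.
Hypotheses (geo : uniquely_geodesic X).
Hypotheses (npc2 : NPC2 X) (npc3 : NPC3 X) (tp : TP X).

Let tpC (p p0 p1 p1' p2 p2' : X) :
  parallel p p0 p1 p1' -> parallel p p0 p2 p2' -> parallel p1 p1' p2 p2'.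
Proof. by move=> /parallel_sym + H; move=> /tp; apply. Qed.

(** On the orbit of [x], the shift from [g x] to [g q x] moves every point parallel to [[x, q x]].
    The condition depends on [x] and not only on [q]. *)
Definition translates x q : Prop :=
  forall g, parallel x (a q x) (a g x) (a g (a q x)).

(** (NPC2) flips parallelograms, so those spanned by [q1] at [x] and by [q2] at [q1 x] can be glued
    by (TP) along their common side [[q1 x, g q1 x]]. *)
Lemma translates_mul x q1 q2 :
  translates x q1 -> translates x q2 -> translates x (q1 * q2)%g.
Proof.
move=> T1 T2 g; apply: npc2; apply: tp (npc2 (T1 g)) _; apply: npc2.
by have := T2 (g * q1)%g; rewrite !actM; apply: tpC; exact: T2.
Qed.

(** The segment [[q^-1 x, x]] and its image under [g] are the images of [[x, q x]] under [q^-1] and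
    [g q^-1]. Both are parallel to [[x, q x]], hence to each other; it remains to reverse them. *)
Lemma translates_inv x q : translates x q -> translates x q^-1%g.
Proof.
move=> T g; apply: parallel_rev => //; apply: (tpC (p := x) (p0 := a q x)).
  by have := T q^-1%g; rewrite actK.
by have := T (g * q^-1)%g; rewrite !actM actK.
Qed.

Lemma translates_subgroup x : subgroup (translates x).
Proof.
split=> [g|q1 q2|q]; [|exact: translates_mul|exact: translates_inv].
by rewrite !act1; apply: parallel_xx.
Qed.

(** The segments from [q1 x] to [q2 q1 x] and to [q1 q2 x] are both parallel to [[x, q2 x]].
    Parallel segments with a common origin have the same end. *)
Lemma translates_comm x q1 q2 : translates x q1 -> translates x q2 ->
  a (q1 * q2)%g x = a (q2 * q1)%g x.
Proof.
move=> T1 T2; rewrite !actM.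
have [+ _] := tpC (npc2 (T1 q2)) (T2 q1).
by rewrite mdistxx => /esym/mdist_positivity.
Qed.

Lemma translates_derived x (Q : set G) q :
  Q `<=` translates x -> derived Q q -> a q x = x.
Proof.
move=> QT; move: q; apply: gen_min; first exact: stabilizer_subgroup.
move=> _ [q1 [q2 [/QT T1 /QT T2 ->]]] /=.
have -> : [~ q1, q2]%g = ((q2 * q1)^-1 * (q1 * q2))%g.
  by rewrite /commg /conjg invgM !mulgA.
by rewrite actM translates_comm // actK.
Qed.

(** With [p = q ^+ (2 ^ k)], the segments [[x, p x]] and [[p x, p p x]] are parallel, so (NPC3)
    doubles the length. Hence the restriction to powers of 2. *)
Lemma translates_double x q k : translates x q ->
  mdist x (a (q ^+ (2 ^ k))%g x) = 2 ^+ k * mdist x (a q x).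
Proof.
move=> T; elim: k => [|k IH]; first by rewrite expn0 expg1 expr0 mul1r.
have Tk : translates x (q ^+ (2 ^ k))%g.
  have [T1 TM _] := translates_subgroup x.
  by elim: (2 ^ k)%N => [|n IHn]; rewrite ?expg0 // expgS; apply: TM.
by rewrite expnS mul2n -addnn expgnDr actM (parallel_double geo npc3 (Tk _)) IH
  exprS mulrA.
Qed.

(** If [d = mdist x (a q x)] is positive, [q ^+ (2 ^ n)] moves [x] by [2 ^ n * d]. Modulo the period
    [n] it moves [x] like a power of exponent below [n], so by less than [n * d], contradicting
    [n < 2 ^ n]. *)
Lemma translates_torsion x q n : translates x q -> (0 < n)%N ->
  a (q ^+ n)%g x = x -> a q x = x.
Proof.
move=> T n0 qn; apply/esym/mdist_positivity/eqP; apply: contraT => d_neq0.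
have d0 : 0 < mdist x (a q x) by rewrite lt_neqAle eq_sym d_neq0 mdist_ge0.
have loop k : a (q ^+ (n * k))%g x = x.
  by elim: k => [|k IH]; rewrite ?muln0 ?expg0 ?act1 // mulnS expgnDr actM IH.
have := translates_double n T; rewrite (divn_eq (2 ^ n) n) addnC mulnC.
rewrite expgnDr actM loop => E.
have := mdist_act_pow q x (2 ^ n %% n); rewrite E -natrX ler_pM2r // ler_nat.
move=> /leq_ltn_trans /(_ (ltn_pmod _ n0)).
by rewrite ltnNge ltnW // ltn_expl.
Qed.

Lemma translates_gen_fixed x (P : set G) : P `<=` translates x ->
  torsion_abelianization (gen P) -> forall q, gen P q -> a q x = x.
Proof.
move=> PT tor q Pq.
have QT : gen P `<=` translates x.
  by apply: gen_min => //; exact: translates_subgroup.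
have [n n0 dq] := tor q Pq.
apply: (translates_torsion (QT _ Pq) n0); exact: translates_derived dq.
Qed.

End Translations.

End Actions.

(** * Displacement functions and twisting an action by an automorphism *)

Definition displacement {R : realType} {G : groupType} {X : metricType R}
    (l : seq G) (a : isom_action G X) (x : X) : R :=
  \sum_(s <- l) mdist x (a s x).

Section Precomposition.
Context {R : realType} {G : groupType} {X : metricType R}.
Variables (a : isom_action G X) (phi : G -> G).
Hypothesis phiM : {morph phi : x y / (x * y)%g}.

Lemma precomp1 x : a (phi 1%g) x = x.
Proof. by rewrite morphism1 // act1. Qed.

Lemma precompM g h x : a (phi (g * h)%g) x = a (phi g) (a (phi h) x).
Proof. by rewrite phiM actM. Qed.

Definition precomp : isom_action G X :=
  Build_isom_action precomp1 precompM (fun g => act_isom a (phi g)).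

End Precomposition.

(** The inner factor only moves the base point to [g^-1 x], and [pi] only reorders the summands. *)
Lemma displacement_precomp (R : realType) (G : groupType) (X : metricType R)
    (a : isom_action G X) (l : seq G) (g : G) (pi : G -> G) x
    (phiM : {morph inn g \o pi : x y / (x * y)%g}) :
  perm_eq (map pi l) l ->
  displacement l (precomp a phiM) x = displacement l a (a g^-1%g x).
Proof.
move=> piE; rewrite /displacement -[RHS](perm_big _ piE) big_map.
apply: eq_bigr => s _ /=; rewrite /inn !actM -[RHS](act_isom a g).
by rewrite actVK.
Qed.

(** * Pairs at minimal distance and the invariant of the game *)

Section Realizers.
Context {R : realType} (XX : metricType R -> Prop).
Hypotheses (npc1 : forall X, XX X -> NPC1 X) (npc2 : forall X, XX X -> NPC2 X).
Hypotheses (npc3 : forall X, XX X -> NPC3 X) (tp : forall X, XX X -> TP X).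
Context {G : groupType} (K : 'I_2 -> set G) (Pi : set (G -> G)).
Hypothesis K_gen : gen [set g | exists i, K i g] = setT.
Hypothesis Pi_aut : aut_subgroup Pi.
Variable l : seq G.
Hypothesis Pi_perm : forall pi, Pi pi -> perm_eq (map pi l) l.
Variables (c D : R).

(** Absence of fixed points alone may be lost in an ultraproduct; a common lower bound [c]
    survives. *)
Definition uniform (X : metricType R) (a : isom_action G X) : Prop :=
  forall x, c <= displacement l a x.

Definition fixes (X : metricType R) (a : isom_action G X) (H : 'I_2 -> set G)
    (z : 'I_2 -> X) : Prop :=
  forall i h, H i h -> a h (z i) = z i.

Hypothesis D_min : forall (X : metricType R) (a : isom_action G X) z,
  XX X -> uniform a -> fixes a K z ->
  forall i j, i != j -> D <= mdist (z i) (z j).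

Definition realizer (X : metricType R) (a : isom_action G X)
    (z : 'I_2 -> X) : Prop :=
  [/\ XX X, uniform a, fixes a K z &
      forall i j, i != j -> mdist (z i) (z j) = D].

(** All realizers are quantified over at once because a type II move applies the invariant to a
    twisted action. *)
Definition stable (H : 'I_2 -> set G) : Prop :=
  forall (X : metricType R) (a : isom_action G X) z,
    realizer a z -> fixes a H z.

(** The midpoints form a pair fixed by [K] for the same action, hence are at distance at least [D];
    (NPC1) bounds that distance above by [D]. *)
Lemma realizer_parallel (X : metricType R) (a : isom_action G X) z h :
  realizer a z ->
  (forall i k, K i k -> a k (a h (z i)) = a h (z i)) ->
  forall i j, parallel (z i) (a h (z i)) (z j) (a h (z j)).
Proof.
move=> [XXX ua Kz zD] Khz i j; have [geo npc] := npc1 XXX.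
have [-> | ij] := eqVneq i j; first exact: parallel_refl.
split; first by rewrite act_isom.
apply/eqP; rewrite eq_le act_isom npc ?half01 ?act_isom // andbT zD //.
apply: (D_min (a := a) (z := fun i => divpt 2^-1 (z i) (a h (z i)))) ij => //.
move=> {}i k Kik; rewrite (divpt_isom geo _ _ (act_isom a k)) ?half01 //.
by rewrite Khz // Kz.
Qed.

Lemma parallel_translates (X : metricType R) (a : isom_action G X) z h :
  realizer a z ->
  (forall i j, parallel (z i) (a h (z i)) (z j) (a h (z j))) ->
  (forall i k, K i k -> a k (a h (z i)) = a h (z i)) ->
  forall i, translates a (z i) h.
Proof.
move=> [XXX ua Kz zD] par Khz i g; have [geo _] := npc1 XXX.
suff /(_ g I) /(_ i) : setT `<=`
  [set g | forall i, parallel (z i) (a h (z i)) (a g (z i)) (a g (a h (z i)))].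
  by [].
rewrite -K_gen; apply: gen_min.
  split=> [j|g1 g2 T1 T2 j|{}g T j].
    by rewrite !act1; exact: parallel_refl.
    rewrite !actM; apply: tp (T1 j) _ => //.
    exact: parallel_isom (act_isom a g1) (T2 j).
  apply: parallel_sym.
  by have := parallel_isom geo (act_isom a g^-1%g) (T j); rewrite !actK.
(* A generator [g] in [K j] fixes both ends of [[z j, h z j]], so [[z i, h z i]] and its image under
   [g] are both parallel to that segment. *)
move=> {}g [j Kjg] {}i; apply: tp (par i j) _ => //.
have := parallel_isom geo (act_isom a g) (par j i).
by rewrite (Kz j) // (Khz j).
Qed.

Lemma stable_move_I H H' : move_I K H H' -> stable H -> stable H'.
Proof.
move=> [P [PK tor HE]] Hst X a z az.
have [XXX _ _ _] := az; have [geo _] := npc1 XXX.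
(* [K i] lies in the conjugate of [H i] by [h], which fixes [h z i] because [H i] fixes [z i]. *)
have Khz h i k : P h -> K i k -> a k (a h (z i)) = a h (z i).
  move=> Ph /(PK i h Ph) [k' Hk' <-]; rewrite -actM /inn mulgVK actM.
  by rewrite (Hst _ _ _ az i).
have PT i : P `<=` translates a (z i).
  move=> h Ph; apply: parallel_translates => // [|j k]; last exact: Khz.
  by apply: realizer_parallel => // j k; exact: Khz.
move=> i; rewrite HE; apply: gen_min; first exact: stabilizer_subgroup.
move=> h [|Ph]; first exact: Hst.
apply: (translates_gen_fixed geo _ _ _ (PT i) tor); [exact: npc2|exact: npc3|
  exact: tp|exact: sub_gen].
Qed.

Lemma stable_move_II s H H' : move_II K Pi s H H' -> stable H -> stable H'.
Proof.
move=> [La [LaPi LaK HE]] Hst X a z az.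
have [XXX ua Kz zD] := az.
move=> i; rewrite HE; apply: gen_min; first exact: stabilizer_subgroup.
move=> h [|[phi Laphi [k Hk <-]]]; first exact: Hst.
have phiM := inn_mul_morph Pi_aut (LaPi _ Laphi).
(* Twisting by [phi] and permuting the two points by [s^-1] gives a realizer again. There [H (s i)]
   fixes the point of index [s i], which is [z i]; in the original action this says that [phi] of
   [H (s i)] fixes [z i]. *)
have bz : realizer (precomp a phiM) (fun j => z ((s^-1)%g j)).
  split=> // [|j k' Kk'|j j' jj'].
  - have [g [pi Pipi phiE]] := LaPi _ Laphi; move: phiM; rewrite phiE => phiM x.
    by rewrite displacement_precomp //; exact: Pi_perm.
  - by apply: (Hst _ _ _ az); apply: (LaK j phi Laphi); exists k'.
  - by apply: zD; rewrite (inj_eq perm_inj).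
by have := Hst _ _ _ bz (s i) k Hk; rewrite /= permK.
Qed.

Lemma stable_reachable H :
  clos_refl_trans _ (move K Pi) K H -> stable H.
Proof.
have : stable K by move=> X a z [].
move=> + KH; elim: KH => [H1 H2 [|[s]]|//|H1 H2 H3 _ IH1 _ IH2 /IH1 /IH2 //].
  exact: stable_move_I.
exact: stable_move_II.
Qed.

End Realizers.

(** * Actions carried along isometries and to ultraproducts *)

Section Transport.
Context {R : realType} {G : groupType} (XX : metricType R -> Prop).

(** Membership of rescalings and ultraproducts holds up to isometry, so their actions are conjugated
    to an actual member of the class. *)
Lemma belongs_action (X : metricType R) (a : isom_action G X) : belongs XX X ->
  exists (Y : metricType R) (b : isom_action G Y) (f : X -> Y),
    [/\ XX Y, (forall y, exists x, f x = y),
        (forall x y, mdist (f x) (f y) = mdist x y) &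
        forall g x, b g (f x) = f (a g x)].
Proof.
move=> [Y XXY [f [f' fK f'K] fd]].
have b1 y : f (a 1%g (f' y)) = y by rewrite act1 f'K.
have bM g h y : f (a (g * h)%g (f' y)) = f (a g (f' (f (a h (f' y))))).
  by rewrite actM fK.
have bd g y z : mdist (f (a g (f' y))) (f (a g (f' z))) = mdist y z.
  by rewrite fd act_isom -fd !f'K.
exists Y, (Build_isom_action b1 bM bd), f; split=> // [y|g x] /=.
  by exists (f' y).
by rewrite fK.
Qed.

End Transport.

Section UltraproductAction.
Context {R : realType} {G : groupType}.
Variables (U : set_system nat) (UU : UltraFilter U).
Variables (X : nat -> metricType R) (w : forall n, X n).
Variable a : forall n, isom_action G (X n).
Hypothesis orbit_bounded : forall g, exists C : R, forall n,
  mdist (a n g (w n)) (w n) <= C.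

Lemma act_bounded g (x : bounded_seq w) :
  bounded_from w (fun n => a n g (val x n)).
Proof.
have /asboolP[C xC] := valP x; have [D gD] := orbit_bounded g.
apply/asboolP; exists (C + D) => n.
apply: le_trans (metric_triangle _ (a n g (w n)) _) _.
by rewrite act_isom lerD.
Qed.

Definition act_seq g (x : bounded_seq w) : bounded_seq w :=
  exist (@bounded_from R X w) _ (act_bounded g x).

Definition ultra_act g (p : ultraproduct UU w) : ultraproduct UU w :=
  (\pi_(ultraproduct UU w) (act_seq g (repr p)))%qT.

Lemma ultra_mdistE (x y : bounded_seq w) :
  mdist (\pi_(ultraproduct UU w) x)%qT (\pi_(ultraproduct UU w) y)%qT
  = ulim_dist U x y.
Proof. exact: ultra_distE. Qed.

Lemma ulim_dist_act g x y :
  ulim_dist U (act_seq g x) (act_seq g y) = ulim_dist U x y.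
Proof.
by rewrite /ulim_dist; congr lim; congr (_ @ U); apply/funext => n;
  rewrite act_isom.
Qed.

(** The chosen representative does not matter: isometries keep sequences at distance 0. *)
Lemma ultra_actE g x :
  ultra_act g (\pi_(ultraproduct UU w) x)%qT =
  (\pi_(ultraproduct UU w) (act_seq g x))%qT.
Proof.
apply: mdist_positivity; rewrite /ultra_act ultra_mdistE ulim_dist_act.
by rewrite -ultra_mdistE reprK mdistxx.
Qed.

Lemma ultra_act1 p : ultra_act 1%g p = p.
Proof.
rewrite -[p]reprK ultra_actE; congr (\pi_(_) _)%qT.
by apply/val_inj/functional_extensionality_dep => n; exact: act1.
Qed.

Lemma ultra_actM g h p : ultra_act (g * h)%g p = ultra_act g (ultra_act h p).
Proof.
rewrite -[p]reprK (ultra_actE h) !ultra_actE; congr (\pi_(_) _)%qT.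
by apply/val_inj/functional_extensionality_dep => n; exact: actM.
Qed.

Lemma ultra_act_isom g p q : mdist (ultra_act g p) (ultra_act g q) = mdist p q.
Proof.
by rewrite -[p]reprK -[q]reprK !ultra_actE !ultra_mdistE ulim_dist_act.
Qed.

Definition ultra_action : isom_action G (ultraproduct UU w) :=
  Build_isom_action ultra_act1 ultra_actM ultra_act_isom.

(** A point of the ultraproduct is represented by a sequence within some [C] of the base points, so
    a bound on each ball for [U]-almost all [n] suffices; the finite sum commutes with the limit. *)
Lemma ultra_displacement_ge l (c : R) :
  (forall C : R, U [set n | forall y, mdist y (w n) <= C ->
     c <= displacement l (a n) y]) ->
  forall p, c <= displacement l ultra_action p.
Proof.
move=> Uc p; rewrite -[p]reprK /displacement.
under eq_bigr do rewrite /= ultra_actE ultra_mdistE.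
set x := repr p; have /asboolP[C xC] := valP x.
have cv : (fun n => displacement l (a n) (val x n)) @ U -->
    \sum_(s <- l) ulim_dist U x (act_seq s x).
  by apply: cvg_big => [|s _]; [exact: add_continuous|exact: ulim_dist_cvg].
apply: (ler_cvg_to (cvg_cst c) cv).
by apply: filterS (Uc C) => n; apply; exact: xC.
Qed.

End UltraproductAction.

(** The points below [N] are removed one by one, since an ultrafilter containing a singleton is
    principal. *)
Lemma nonprincipal_cofinite (U : set_system nat) : UltraFilter U ->
  nonprincipal U -> forall N, U [set n | (N <= n)%N].
Proof.
move=> UU Unp; elim=> [|N IH]; first exact: filterE.
have [UN|] := in_ultra_setVsetC [set N] UU.
  case: (Unp N); apply: (@max_filter _ _ (principal_filter_ultra N)) => A.
  move=> /principal_filterP AN.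
  by apply: filterS UN => _ ->.
move=> /(filterI IH); apply: filterS => n [/= Nn nN].
by rewrite ltn_neqAle Nn andbT; apply/eqP => E; apply: nN.
Qed.

(** * Almost minima on complete spaces *)

Section AlmostMinimum.
Context {R : realType} {X : metricType R} (f : X -> R).
Hypothesis X_complete : complete_space X.
Hypothesis f_lower : forall x, exists2 e, 0 < e &
  forall y, mdist x y < e -> e <= f y.

Lemma pow2_small (C e : R) : 0 <= C -> 0 < e -> exists N, C / 2 ^+ N < e.
Proof.
move=> C0 e0; exists (Num.bound (C / e)).
have := archi_boundP (divr_ge0 C0 (ltW e0)); set N := Num.bound _ => CN.
rewrite ltr_pdivrMr ?exprn_gt0 // mulrC -ltr_pdivrMr //.
by rewrite (lt_trans CN) // -natrX ltr_nat ltn_expl.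
Qed.

Lemma geometric_cvg (u : nat -> X) (C : R) : 0 <= C ->
  (forall k, mdist (u k) (u k.+1) <= C / 2 ^+ k) -> exists x : X, u @ \oo --> x.
Proof.
move=> C0 uC; apply: X_complete; apply: cauchy_exP => e e0.
have [N Ne] := pow2_small (mulr_ge0 (ler0n _ 2) C0) e0.
exists (u N); exists N => // n /= /subnKC <-; rewrite ballEmdist /=.
apply: le_lt_trans Ne; move: (n - N)%N => m.
(* The right-hand side is the closed form of the sum of [C / 2 ^+ k] for [k] from [N] to
   [N + m - 1], which makes the induction on [m] telescope. *)
suff : mdist (u N) (u (N + m)%N) <= 2 * C / 2 ^+ N - 2 * C / 2 ^+ (N + m).
  move=> /le_trans; apply.
  by rewrite gerBl mulr_ge0 ?invr_ge0 ?exprn_ge0 ?mulr_ge0.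
elim: m => [|m IH]; first by rewrite addn0 mdistxx subrr.
rewrite addnS.
apply: le_trans (metric_triangle _ (u (N + m)%N) _) _.
apply: le_trans (lerD IH (uC _)) _; rewrite exprS.
rewrite [2 * C / (2 * _)](_ : _ = C / 2 ^+ (N + m)); first by lra.
by rewrite -mulf_div divff ?pnatr_eq0 // mul1r.
Qed.

(* Otherwise [f] could be halved forever along a Cauchy sequence, whose limit
   contradicts [f_lower]. *)
Lemma almost_minimum x0 (r : R) : 0 <= r -> exists2 x, f x <= f x0 &
  forall y, mdist x y <= r * f x -> f x / 2 <= f y.
Proof.
move=> r0; apply: contrapT => nmin.
have f_ge0 x : 0 <= f x.
  have [e e0 fe] := f_lower x.
  by apply: le_trans (ltW e0) _; apply: fe; rewrite mdistxx.
(* Points with [f x] above [f x0] get themselves as an irrelevant default; the iterates of [x0]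
   never reach them. *)
have /choice[step stepP] : forall x : X, exists y : X, f x <= f x0 ->
    mdist x y <= r * f x /\ f y < f x / 2.
  move=> x; have [fx|] := pselect (f x <= f x0); last by exists x.
  apply: contrapT => nstep; apply: nmin; exists x => // y xy.
  by rewrite leNgt; apply/negP => fy; apply: nstep; exists y.
pose u k := iter k step x0.
have u_small k : f (u k) <= f x0 / 2 ^+ k.
  elim: k => [|k IH]; first by rewrite expr0 divr1.
  have fk : f (u k) <= f x0.
    apply: le_trans IH _; rewrite ler_pdivrMr ?exprn_gt0 //.
    by rewrite ler_peMr // exprn_ege1 // ler1n.
  have [_ /ltW] := stepP _ fk; rewrite -/(u k.+1) => /le_trans; apply.
  by rewrite exprSr invfM mulrA ler_pM2r ?invr_gt0.
have u_le k : f (u k) <= f x0.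
  apply: le_trans (u_small k) _; rewrite ler_pdivrMr ?exprn_gt0 //.
  by rewrite ler_peMr // exprn_ege1 // ler1n.
have [|k|x ux] := @geometric_cvg u (r * f x0); first exact: mulr_ge0.
  have [+ _] := stepP _ (u_le k); rewrite -/(u k.+1) => /le_trans; apply.
  by rewrite -mulrA ler_wpM2l.
have [e e0 fe] := f_lower x.
have [N Ne] := pow2_small (f_ge0 x0) e0.
have [M _ uM] := cvg_ball ux e0.
have := uM (maxn M N) (leq_maxl _ _); rewrite ballEmdist => /fe.
apply/negP; rewrite -ltNge; apply: le_lt_trans (u_small _) (le_lt_trans _ Ne).
rewrite ler_wpM2l // lef_pV2 ?posrE ?exprn_gt0 //.
by rewrite ler_eXn2l ?leq_maxr // ltr1n.
Qed.

End AlmostMinimum.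

(** * Uniform actions and the attained minimal distance *)

Section UniformActions.
Context {R : realType} {G : groupType}.

Lemma displacement_ge0 (X : metricType R) l (a : isom_action G X) x :
  0 <= displacement l a x.
Proof. by apply: sumr_ge0 => s _; exact: mdist_ge0. Qed.

Lemma mdist_le_displacement (X : metricType R) l (a : isom_action G X) x s :
  s \in l -> mdist x (a s x) <= displacement l a x.
Proof.
move=> sl; rewrite /displacement (perm_big _ (perm_to_rem sl)) big_cons lerDl.
by apply: sumr_ge0 => t _; exact: mdist_ge0.
Qed.

Lemma displacement_lipschitz (X : metricType R) l (a : isom_action G X) x y :
  displacement l a x <= displacement l a y + (2 * size l)%:R * mdist x y.
Proof.
rewrite /displacement; elim: l => [|s l IH].
  by rewrite !big_nil muln0 mul0r addr0.
rewrite !big_cons /= mulnS natrD mulrDl addrACA lerD //.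
apply: le_trans (metric_triangle _ y _) _.
apply: le_trans (lerD (lexx _) (metric_triangle _ (a s y) _)) _.
by rewrite act_isom [mdist y x]metric_sym; lra.
Qed.

Lemma displacement_equivariant (X Y : metricType R) l (a : isom_action G X)
    (b : isom_action G Y) (f : X -> Y) x :
  (forall x y, mdist (f x) (f y) = mdist x y) ->
  (forall g x, b g (f x) = f (a g x)) ->
  displacement l b (f x) = displacement l a x.
Proof. by move=> fd fa; apply: eq_bigr => s _; rewrite fa fd. Qed.

Lemma displacement_gt0 (X : metricType R) l (a : isom_action G X) x :
  gen [set` l] = setT -> fixed_points a setT = set0 -> 0 < displacement l a x.
Proof.
move=> genl fix0; rewrite lt_neqAle displacement_ge0 andbT eq_sym.
apply/eqP => d0; suff : fixed_points a setT x by rewrite fix0.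
move=> h _; suff : gen [set` l] `<=` [set h | a h x = x] by rewrite genl; exact.
apply: gen_min => [|s /= sl]; first exact: stabilizer_subgroup.
apply/esym/mdist_positivity/eqP; rewrite eq_le mdist_ge0 andbT -d0.
exact: mdist_le_displacement.
Qed.

Lemma displacement_lower (X : metricType R) l (a : isom_action G X) x :
  0 < displacement l a x ->
  exists2 e, 0 < e & forall y, mdist x y < e -> e <= displacement l a y.
Proof.
(* The displacement is Lipschitz with constant [2 * size l]; on the ball of radius [e] it loses at
   most that multiple of [e] and keeps [e]. *)
move=> d0; exists (displacement l a x / (2 * size l).+1%:R).
  by rewrite divr_gt0.
set e := _ / _ => y xy.
have dE : displacement l a x = e * (2 * size l).+1%:R.
  by rewrite divfK ?pnatr_eq0.
have := displacement_lipschitz l a x y; rewrite dE -natr1 => H.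
have := ler_wpM2l (ler0n R (2 * size l)) (ltW xy).
by move: H; lra.
Qed.

Lemma orbit_bounded_subgroup (X : nat -> metricType R) (w : forall n, X n)
    (a : forall n, isom_action G (X n)) :
  subgroup [set g | exists C : R, forall n, mdist (a n g (w n)) (w n) <= C].
Proof.
split=> [|g h [C gC] [D hD]|g [C gC]].
- by exists 0 => n; rewrite act1 mdistxx.
- exists (C + D) => n; rewrite actM addrC.
  apply: le_trans (metric_triangle _ (a n g (w n)) _) _.
  by rewrite act_isom lerD.
- exists C => n; rewrite -(act_isom (a n) g) actVK metric_sym; exact: gC.
Qed.

Section Rescaling.
Variables (X : metricType R) (a : isom_action G X) (r : R) (r1 : 1 <= r).

Lemma rescale_mdistE (x y : X) :
  mdist (x : rescale r1 X) (y : rescale r1 X) = r * mdist x y.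
Proof. by []. Qed.

Lemma rescale_isom g (x y : rescale r1 X) :
  mdist (a g x : rescale r1 X) (a g y : rescale r1 X) = mdist x y.
Proof. by rewrite !rescale_mdistE act_isom. Qed.

Definition rescale_action : isom_action G (rescale r1 X) :=
  @Build_isom_action R G (rescale r1 X) (fun g => a g) (act1 a) (actM a)
    rescale_isom.

Lemma rescale_displacement l (x : X) :
  displacement l rescale_action x = r * displacement l a x.
Proof. by rewrite /displacement mulr_sumr. Qed.

End Rescaling.

(** Bundled so that [choice] can produce a sequence of actions; [I] is [unit] for a base point and
    ['I_2] for a pair. *)
Record pointed_action (I : Type) := PointedAction {
  pa_space : metricType R;
  pa_act : isom_action G pa_space;
  pa_pt : I -> pa_space }.

Variable XX : metricType R -> Prop.
Hypothesis XX_complete : forall X, XX X -> complete_space X.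
Hypothesis XX_S_plus : S_plus XX.
Hypothesis XX_U : U_closed XX.

(* If displacements get arbitrarily small, rescale at almost minima so that the
   displacement is 1 at the base point and at least 1/2 on larger and larger
   balls. Small displacements make the factor at least 1, as (S+) requires. *)
Lemma uniform_action_exists l : gen [set` l] = setT -> ~ property_F XX G ->
  exists2 c : R, 0 < c & exists (X : metricType R) (a : isom_action G X),
    XX X /\ forall x, c <= displacement l a x.
Proof.
move=> genl nF.
have [X [a [XXX fix0]]] : exists (X : metricType R) (a : isom_action G X),
    XX X /\ fixed_points a setT = set0.
  apply: contrapT => nex; apply: nF => X XXX a; apply/set0P/eqP => fix0.
  by apply: nex; exists X, a.
have d0 x := displacement_gt0 x genl fix0.
have [[c c0 cd]|small] := pselect (exists2 c, 0 < c &
    forall x, c <= displacement l a x); first by exists c => //; exists X, a.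
have [x0 x01] : exists x, displacement l a x < 1.
  apply: contrapT => nx; apply: small; exists 1 => // x.
  by rewrite leNgt; apply/negP => ?; apply: nx; exists x.
have /choice[T HT] : forall n : nat, exists T : pointed_action unit,
    [/\ XX (pa_space T), displacement l (pa_act T) (pa_pt T tt) = 1 &
        forall y, mdist y (pa_pt T tt) <= n%:R ->
          2^-1 <= displacement l (pa_act T) y].
  move=> n.
  have [|x xx0 xmin] := @almost_minimum _ _ (displacement l a)
    (XX_complete XXX) _ x0 n%:R (ler0n _ _).
    by move=> x; exact: displacement_lower.
  set t := displacement l a x in xx0 xmin.
  have t0 : 0 < t by exact: d0.
  (* Scaling by [t^-1] turns the displacement [t] at [x] into 1, the radius [n * t] into [n] and the
     bound [t / 2] into [1 / 2]. *)
  have r1 : 1 <= t^-1 by rewrite invf_ge1 // (le_trans xx0 (ltW x01)).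
  have [Y [b [f [XXY f_sur fd fb]]]] :=
    belongs_action (rescale_action a r1) (XX_S_plus r1 XXX).
  exists (PointedAction b (fun _ : unit => f x)); split=> //= [|y].
    rewrite (displacement_equivariant _ _ fd fb) rescale_displacement mulVf //.
    exact: lt0r_neq0.
  have [y' <-] := f_sur y; rewrite (displacement_equivariant _ _ fd fb) fd.
  rewrite rescale_displacement metric_sym rescale_mdistE.
  rewrite [_^-1 * _]mulrC [_^-1 * _]mulrC ler_pdivrMr // ler_pdivlMr //.
  by rewrite [2^-1 * _]mulrC; exact: xmin.
have [U [UU [Unp XXU]]] := XX_U.
pose w n := pa_pt (T n) tt.
have bnd g : exists C : R, forall n, mdist (pa_act (T n) g (w n)) (w n) <= C.
  suff : gen [set` l] `<=` [set g | exists C : R,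
    forall n, mdist (pa_act (T n) g (w n)) (w n) <= C] by rewrite genl; apply.
  apply: gen_min => [|s /= sl]; first exact: orbit_bounded_subgroup.
  exists 1 => n; have [_ <- _] := HT n; rewrite metric_sym.
  exact: mdist_le_displacement.
have XXT n : XX (pa_space (T n)) by have [] := HT n.
have [Y [b [f [XXY f_sur fd fb]]]] :=
  belongs_action (ultra_action UU bnd) (XXU _ w XXT).
exists 2^-1; first by rewrite invr_gt0.
exists Y, b; split=> // y; have [p <-] := f_sur y.
rewrite (displacement_equivariant _ _ fd fb).
apply: ultra_displacement_ge => C.
(* For [n] beyond [C], the ball of radius [C] lies in the ball of radius [n] where the bound [1 / 2]
   is known. *)
apply: filterS (nonprincipal_cofinite UU Unp (Num.bound `|C|)) => n /= Cn z zC.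
have [_ _ Tc] := HT n; apply: Tc; apply: le_trans zC (le_trans (ler_norm C) _).
by apply: le_trans (ltW (archi_boundP (normr_ge0 C))) _; rewrite ler_nat.
Qed.

Lemma realizer_exists (K : 'I_2 -> set G) l (c : R) :
  gen [set g | exists i, K i g] = setT ->
  (forall i, relative_F XX (K i)) ->
  (exists (X : metricType R) (a : isom_action G X),
     XX X /\ forall x, c <= displacement l a x) ->
  exists D : R,
    (forall (X : metricType R) (a : isom_action G X) z, XX X ->
       uniform l c a -> fixes a K z ->
       forall i j, i != j -> D <= mdist (z i) (z j)) /\
    exists (X : metricType R) (a : isom_action G X) z, realizer XX K l c D a z.
Proof.
move=> K_gen relF [X0 [a0 [XXX0 u0]]].
pose S := [set d | exists (X : metricType R) (a : isom_action G X) z,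
  [/\ XX X, uniform l c a, fixes a K z & d = mdist (z ord0) (z ord_max)]].
have ord2 (X : metricType R) (z : 'I_2 -> X) i j : i != j ->
    mdist (z i) (z j) = mdist (z ord0) (z ord_max).
  by case: i j => [[|[|//]] ip] [[|[|//]] jp] //= _; [|rewrite metric_sym];
    congr (mdist (z _) (z _)); exact: val_inj.
have S_ge0 : lbound S 0 by move=> _ [X [a [z [_ _ _ ->]]]]; exact: mdist_ge0.
have S_inf : has_inf S.
  split; last by exists 0.
  have /choice[z zK] i : exists x, fixed_points a0 (K i) x by exact: relF.
  by exists (mdist (z ord0) (z ord_max)), X0, a0, z.
have D_min (X : metricType R) (a : isom_action G X) z : XX X ->
    uniform l c a -> fixes a K z -> forall i j, i != j ->
    inf S <= mdist (z i) (z j).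
  move=> XXX ua za i j ij; apply: ge_inf; first by exists 0.
  by exists X, a, z; rewrite (ord2 _ _ _ _ ij).
exists (inf S); split=> //.
(* A minimizing sequence of pairs, whose ultraproduct attains the infimum. *)
have /choice[T HT] : forall n : nat, exists T : pointed_action 'I_2,
    [/\ XX (pa_space T), uniform l c (pa_act T), fixes (pa_act T) K (pa_pt T) &
        mdist (pa_pt T ord0) (pa_pt T ord_max) <= inf S + n.+1%:R^-1].
  move=> n; have n0 : 0 < n.+1%:R^-1 :> R by rewrite invr_gt0.
  have [_ [X [a [z [XXX ua za ->]]]] /ltW zS] := inf_adherent n0 S_inf.
  by exists (PointedAction a z).
have [U [UU [Unp XXU]]] := XX_U.
pose w n := pa_pt (T n) ord0.
have dw n i : mdist (pa_pt (T n) i) (w n) <= inf S + 1.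
  have S0 : 0 <= inf S by exact: lb_le_inf S_inf.1 S_ge0.
  have [->|i0] := eqVneq i ord0; first by rewrite mdistxx; lra.
  rewrite (ord2 _ _ _ _ i0); have [_ _ _] := HT n; move/le_trans; apply.
  by rewrite lerD2l invf_le1 // ler1n.
have bnd g : exists C : R, forall n, mdist (pa_act (T n) g (w n)) (w n) <= C.
  suff : gen [set g | exists i, K i g] `<=` [set g | exists C : R,
    forall n, mdist (pa_act (T n) g (w n)) (w n) <= C] by rewrite K_gen; apply.
  apply: gen_min => [|{}g /= [i Kg]]; first exact: orbit_bounded_subgroup.
  (* An element of [K i] fixes the [i]-th point, which is within [inf S + 1] of the base point, so
     it moves the base point by at most twice that. *)
  exists ((inf S + 1) + (inf S + 1)) => n.
  apply: le_trans (metric_triangle _ (pa_pt (T n) i) _) _.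
  have [_ _ /(_ i g Kg) {1}<- _] := HT n.
  by rewrite act_isom lerD // metric_sym.
have XXT n : XX (pa_space (T n)) by have [] := HT n.
have [Y [b [f [XXY f_sur fd fb]]]] :=
  belongs_action (ultra_action UU bnd) (XXU _ w XXT).
have zb i : bounded_from w (fun n => pa_pt (T n) i).
  by apply/asboolP; exists (inf S + 1) => n.
pose z i : bounded_seq w := exist (@bounded_from R _ w) _ (zb i).
pose fz i := f (\pi_(ultraproduct UU w) (z i))%qT.
have ub : uniform l c b.
  move=> y; have [p <-] := f_sur y.
  rewrite (displacement_equivariant _ _ fd fb).
  apply: ultra_displacement_ge => C; apply: (@filterE _ U) => n x _.
  by have [_ Tu _ _] := HT n; apply: Tu.
have fzb : fixes b K fz.
  move=> i g Kg; rewrite /fz fb /= ultra_actE; congr (f (\pi_(_) _)%qT).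
  apply/val_inj/functional_extensionality_dep => n /=.
  by have [_ _ Tz _] := HT n; apply: Tz.
exists Y, b, fz; split=> // i j ij.
apply/eqP; rewrite eq_le (D_min Y b) // andbT.
rewrite (ord2 _ _ _ _ ij) fd ultra_mdistE; apply/ler_addgt0Pr => e e0.
apply: (ler_cvg_to (@ulim_dist_cvg _ _ UU _ _ _ _) (cvg_cst (inf S + e))).
apply: filterS (nonprincipal_cofinite UU Unp (Num.bound e^-1)) => n /= en.
have [_ _ _] := HT n; move/le_trans; apply; rewrite lerD2l.
have e0' : 0 <= e^-1 by rewrite invr_ge0 ltW.
rewrite invf_ple ?posrE //; apply: le_trans (ltW (archi_boundP e0')) _.
by rewrite ler_nat (leq_trans en).
Qed.

End UniformActions.

(** * A [Pi]-invariant generating list and the final contradiction *)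

Lemma invariant_generating_seq (G : groupType) (Pi : set (G -> G)) :
  fin_gen G -> finite_set Pi -> aut_subgroup Pi ->
  exists2 l : seq G, gen [set` l] = setT &
    forall pi, Pi pi -> perm_eq (map pi l) l.
Proof.
move=> [S Sfin Sgen] Pifin [Piaut Pi1 PiM _].
(* The images of [S] under the finite group [Pi] form a finite set mapped into itself by each [pi];
   being injective, [pi] permutes it. Duplicates are removed so that this gives a permutation of
   lists. *)
have : finite_set (\bigcup_(pi in Pi) (pi @` S)).
  by apply: bigcup_finite => // pi _; exact: finite_image.
move=> /finite_seqP[l lE]; exists (undup l).
  apply/seteqP; split=> // x _; have : gen S x by rewrite Sgen.
  apply: gen_min; first exact: gen_subgroup.
  move=> s Ss; apply: sub_gen; rewrite /= mem_undup.
  suff : [set` l] s by [].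
  by rewrite -lE; exists idfun => //; exists s.
move=> pi Pipi; have [_ /bij_inj pi_inj] := Piaut _ Pipi.
have u : uniq (map pi (undup l)) by rewrite map_inj_uniq // undup_uniq.
apply: uniq_perm; rewrite ?undup_uniq //.
have sub : {subset map pi (undup l) <= undup l}.
  move=> _ /mapP[x + ->]; rewrite !mem_undup => xl.
  suff : [set` l] (pi x) by [].
  have : [set` l] x by [].
  rewrite -lE => -[phi Piphi [s Ss <-]].
  by exists (pi \o phi); [exact: PiM|exists s].
have sz : (size (undup l) <= size (map pi (undup l)))%N by rewrite size_map.
by have [] := uniq_min_size u sub sz.
Qed.

Theorem theorem1 (R : realType) (XX : metricType R -> Prop)
    (XX_nonempty : exists X, XX X)
    (XX_spaces : forall X, XX X -> inhabited X /\ complete_space X)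
    (XX_S_plus : S_plus XX)
    (XX_U : U_closed XX)
    (XX_NPC1 : forall X, XX X -> NPC1 X)
    (XX_NPC2 : forall X, XX X -> NPC2 X)
    (XX_NPC3 : forall X, XX X -> NPC3 X)
    (XX_TP : forall X, XX X -> TP X)
    (G : groupType) (G_fin_gen : fin_gen G)
    (M L : set G) (M_subgroup : subgroup M) (L_subgroup : subgroup L)
    (Pi : set (G -> G)) (Pi_subgroup : aut_subgroup Pi)
    (ML_gen : gen (M `|` L)%classic = setT)
    (Pi_finite : finite_set Pi)
    (game : game_winnable M L Pi)
    (relF_M : relative_F XX M) (relF_L : relative_F XX L) :
  property_F XX G.
Proof.
apply: contrapT => nF.
have [l genl Pi_perm] :=
  invariant_generating_seq G_fin_gen Pi_finite Pi_subgroup.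
have XX_complete X : XX X -> complete_space X by move/XX_spaces => [].
have [c c0 uni] := uniform_action_exists XX_complete XX_S_plus XX_U genl nF.
have K_gen : gen [set g | exists i, pair_of M L i g] = setT.
  rewrite -ML_gen; congr gen; apply/seteqP; split=> g.
    by case=> i; rewrite /pair_of; case: ifP => _ ?; [left|right].
  by case=> ?; [exists ord0|exists ord_max].
have relF i : relative_F XX (pair_of M L i) by rewrite /pair_of; case: ifP.
have [D [D_min [X [a [z az]]]]] := realizer_exists XX_U K_gen relF uni.
have [H KH [i HT]] := game.
have st := stable_reachable XX_NPC1 XX_NPC2 XX_NPC3 XX_TP K_gen Pi_subgroup
  Pi_perm D_min KH.
have [_ ua _ _] := az; have := ua (z i); rewrite leNgt => /negP; apply.
rewrite /displacement big1_seq // => s _.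
by rewrite (st _ _ _ az) ?HT // mdistxx.
Qed.
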